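(* Let $p,q\in\mathbb{C}$ with $p+q\neq 0$, and consider the difference equation $w_{n+1}=\dfrac{1}{1+pw_n+qw_{n-1}}$, $n=0,1,\ldots$, with complex initial conditions $w_{-1},w_0$. If $$\left|\frac{4p}{\left(1+\sqrt{1+4p+4q}\right)^2}\right|+\left|\frac{4q}{\left(1+\sqrt{1+4p+4q}\right)^2}\right|<1,$$ then the equilibrium $\bar w_2=\dfrac{-1+\sqrt{1+4p+4q}}{2(p+q)}$ of this equation is locally asymptotically stable.
   Context: $\sqrt{\cdot}$ denotes the principal complex square root (the same value in every occurrence). For a second order difference equation $w_{n+1}=f(w_n,w_{n-1})$ over $\mathbb{C}$, an equilibrium is a point $\bar w$ with $f(\bar w,\bar w)=\bar w$. It is locally stable if for every $\epsilon>0$ there exists $\delta>0$ such that for all $w_0,w_{-1}\in\mathbb{C}$ with $|w_0-\bar w|+|w_{-1}-\bar w|<\delta$ the solution satisfies $|w_n-\bar w|<\epsilon$ for all $n>-1$. It is locally asymptotically stable if it is locally stable and there exists $\gamma>0$ such that for all $w_0,w_{-1}\in\mathbb{C}$ with $|w_0-\bar w|+|w_{-1}-\bar w|<\gamma$ we have $\lim_{n\to\infty}w_n=\bar w$. *)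

(* Defs.v *)
From mathcomp Require Import all_boot all_order all_algebra.
From mathcomp Require Import complex.
From mathcomp Require Import all_classical all_reals all_analysis.

Set Implicit Arguments.
Unset Strict Implicit.
Unset Printing Implicit Defensive.

Import Order.TTheory GRing.Theory Num.Theory.
Import numFieldNormedType.Exports.

Local Open Scope ring_scope.
Local Open Scope complex_scope.
Local Open Scope classical_set_scope.

(* The topology of a numFieldType (induced by its norm) is attached to the
   projection [Num.NumField.sort], so it is not found on the bare type [R[i]]. *)
Definition complex_numField (R : realType) : numFieldType := R[i].

(* A second order difference equation w_{n+1} = f(w_n, w_{n-1}) is given by a
   partial function [f x y], equal to [None] where the right-hand side is
   undefined.  Sequences are shifted by one: [w n] is w_{n-1}, so that [w 0]
   and [w 1] are the initial conditions w_{-1} and w_0. *)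
Definition is_solution (R : realType) (f : R[i] -> R[i] -> option R[i])
    (wm1 w0 : R[i]) (w : nat -> R[i]) : Prop :=
  [/\ w 0%N = wm1, w 1%N = w0 & forall n, f (w n.+1) (w n) = Some (w n.+2)].

Definition is_equilibrium (R : realType) (f : R[i] -> R[i] -> option R[i])
    (wbar : R[i]) : Prop :=
  f wbar wbar = Some wbar.

(* There is at most one solution with given initial conditions, so [exists w]
   below says that the solution is defined for all n and has the property. *)
Definition locally_stable (R : realType) (f : R[i] -> R[i] -> option R[i])
    (wbar : R[i]) : Prop :=
  forall e : R, 0 < e -> exists2 d : R, 0 < d &
    forall w0 wm1 : R[i], `|w0 - wbar| + `|wm1 - wbar| < d%:C ->
      exists2 w : nat -> R[i], is_solution f wm1 w0 w &
        forall n, `|w n.+1 - wbar| < e%:C.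

Definition locally_asymptotically_stable (R : realType)
    (f : R[i] -> R[i] -> option R[i]) (wbar : R[i]) : Prop :=
  locally_stable f wbar /\
  exists2 g : R, 0 < g &
    forall w0 wm1 : R[i], `|w0 - wbar| + `|wm1 - wbar| < g%:C ->
      exists2 w : nat -> R[i], is_solution f wm1 w0 w &
        (w : nat -> complex_numField R) n @[n --> \oo] -->
          (wbar : complex_numField R).

Definition rational_map (R : realType) (p q x y : R[i]) : option R[i] :=
  if 1 + p * x + q * y == 0 then None else Some (1 / (1 + p * x + q * y)).

(* Main.v *)
Require Import Defs.
From mathcomp Require Import all_boot all_order all_algebra.
From mathcomp Require Import complex.
From mathcomp Require Import all_classical all_reals all_analysis.
From mathcomp Require Import ring lra.
Import Order.TTheory GRing.Theory Num.Theory.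
Import numFieldNormedType.Exports.
Local Open Scope ring_scope.
Local Open Scope complex_scope.

(** Let [s] be the principal square root of [1 + 4 p + 4 q].  Because
    [(s - 1) (s + 1) = 4 (p + q)], the equilibrium equals [W = 2 / (1 + s)], and
    the hypothesis says that [|p W^2| + |q W^2| < 1].
    Since [1 + (p + q) W = 1 / W], this is the assertion that the two partial
    derivatives [- p W^2] and [- q W^2] of the right-hand side at [(W, W)] have
    moduli summing to [k < 1].  Instead of passing through the characteristic
    roots of the linearization, the proof uses this sum directly: with
    [u = x - W] and [v = y - W],
      [1 / (1 + p x + q y) - W
         = - (p W^2 u + q W^2 v) / (1 + p W u + q W v)],
    so near [W] the denominator is close to 1 and the next error is at most
    [c] times the larger of the two previous ones, for a fixed [c] in [(k, 1)]
    (lemma [rational_map_contracts]).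

    A second order equation whose map has this property is asymptotically
    stable (lemma [contracts_near_asymptotically_stable]): two consecutive
    steps shrink the maximum of two successive errors by [c], so the [n]-th
    error is at most [c ^ floor (n / 2)] times the initial one.  In particular
    the orbit never leaves the ball in which the map is defined, so the
    solution exists for all times. *)

(** * Second order equations contracting in the maximum norm *)

(** The bound [d] stands for any upper bound of the two errors; quantifying over
    it replaces a maximum of complex-valued norms. *)
Definition contracts_near {R : realType} (f : R[i] -> R[i] -> option R[i])
    (wbar : R[i]) (c r : R) : Prop :=
  forall (d : R) (x y : R[i]), 0 <= d <= r ->
    `|x - wbar| <= d%:C -> `|y - wbar| <= d%:C ->
    exists2 z, f x y = Some z & `|z - wbar| <= (c * d)%:C.

(** The exponent is halved because an error is compared with the two preceding
    ones, so one factor [c] is gained only every other step. *)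
Lemma contracting_solution (R : realType) (f : R[i] -> R[i] -> option R[i])
    (wbar : R[i]) (c r d : R) (wm1 w0 : R[i]) :
  0 <= c <= 1 -> contracts_near f wbar c r -> 0 <= d <= r ->
  `|w0 - wbar| <= d%:C -> `|wm1 - wbar| <= d%:C ->
  exists2 w : nat -> R[i], is_solution f wm1 w0 w &
    forall n, `|w n - wbar| <= (c ^+ n./2 * d)%:C.
Proof.
move=> /andP[c0 c1] hf /andP[d0 dr] h0 hm1.
pose step (s : R[i] * R[i]) := (s.2, odflt 0 (f s.2 s.1)).
pose w n := (iter n step (wm1, w0)).1.
have wS n : (iter n step (wm1, w0)).2 = w n.+1 by rewrite /w iterS.
have wSS n : w n.+2 = odflt 0 (f (w n.+1) (w n)) by rewrite -wS iterS /= wS.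
have next n : `|w n - wbar| <= (c ^+ n./2 * d)%:C ->
    `|w n.+1 - wbar| <= (c ^+ n.+1./2 * d)%:C ->
    f (w n.+1) (w n) = Some (w n.+2) /\
    `|w n.+2 - wbar| <= (c ^+ n.+2./2 * d)%:C.
  move=> e0 e1.
  have cn1 : c ^+ n./2 <= 1 by rewrite exprn_ile1.
  have e1' : `|w n.+1 - wbar| <= (c ^+ n./2 * d)%:C.
    apply: (le_trans e1); rewrite lecR ler_wpM2r // ler_wiXn2l //.
    exact: half_leq.
  have dn : 0 <= c ^+ n./2 * d <= r.
    by rewrite mulr_ge0 ?exprn_ge0 //= (le_trans _ dr) // ler_piMl.
  have [z fz zP] := hf _ _ _ dn e1' e0.
  by rewrite wSS fz /=; split=> //; rewrite exprS -mulrA.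
have err n : `|w n - wbar| <= (c ^+ n./2 * d)%:C /\
    `|w n.+1 - wbar| <= (c ^+ n.+1./2 * d)%:C.
  elim: n => [|n [e0 e1]]; first by rewrite /w /= expr0 mul1r.
  by split=> //; have [] := next n e0 e1.
exists w => [|n]; last by have [] := err n.
by split=> // n; have [e0 e1] := err n; have [] := next n e0 e1.
Qed.

Lemma contracts_near_asymptotically_stable (R : realType)
    (f : R[i] -> R[i] -> option R[i]) (wbar : R[i]) (c r : R) :
  0 <= c < 1 -> 0 < r -> contracts_near f wbar c r ->
  locally_asymptotically_stable f wbar.
Proof.
move=> /andP[c0 c1] r0 hf.
have c01 : 0 <= c <= 1 by rewrite c0 ltW.
have sol d (w0 wm1 : R[i]) : 0 <= d <= r ->
    `|w0 - wbar| + `|wm1 - wbar| < d%:C ->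
    exists2 w : nat -> R[i], is_solution f wm1 w0 w &
      forall n, `|w n - wbar| <= (c ^+ n./2 * d)%:C.
  move=> dr h; apply: (@contracting_solution _ _ _ _ r) => //.
    by apply: le_trans (ltW h); rewrite lerDl.
  by apply: le_trans (ltW h); rewrite lerDr.
split.
  move=> e e0.
  have d0 : 0 < Num.min r (e / 2) by rewrite lt_min r0 divr_gt0.
  have dr : 0 <= Num.min r (e / 2) <= r by rewrite (ltW d0) ge_min lexx.
  exists (Num.min r (e / 2)) => // w0 wm1 h.
  have [w ws we] := sol _ _ _ dr h.
  exists w => // n; apply: le_lt_trans (we n.+1) _; rewrite ltcR.
  apply: (@le_lt_trans _ _ (Num.min r (e / 2))).
    by rewrite ler_piMl ?(ltW d0) // exprn_ile1 // ltW.
  by rewrite gt_min; apply/orP; right; lra.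
exists r => // w0 wm1 h.
have rr : 0 <= r <= r by rewrite lexx ltW.
have [w ws we] := sol _ _ _ rr h.
exists w => //; apply/cvgrPdist_lt => eps eps0.
(* A positive element of [R[i]] is the image of a positive real. *)
have epsE : (complex.Re eps)%:C = eps :> R[i].
  by apply: RRe_real; apply: gtr0_real.
have e0 : 0 < complex.Re eps by rewrite -ltcR epsE.
have /cvgrPdist_lt cn : ((fun n => c ^+ n : R) @ \oo --> (0 : R))%classic.
  by apply: cvg_expr; rewrite ger0_norm.
have [N _ hN] := cn _ (divr_gt0 e0 r0).
exists N.*2 => // n /= Nn.
rewrite distrC -epsE; apply: le_lt_trans (we n) _; rewrite ltcR -ltr_pdivlMr //.
have : (N <= n./2)%N by rewrite -(doubleK N) half_leq.
by move=> /hN /=; rewrite sub0r normrN ger0_norm // exprn_ge0.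
Qed.

(** * The rational map near its equilibrium *)

(** Radius and factor come from taking [c] halfway between [k] and 1: the radius
    makes the denominator of the error formula at least [c] in modulus, and
    [k / c <= c] because [k <= c ^ 2]. *)
Lemma rational_map_contracts (R : realType) (p q W : R[i]) :
  W != 0 -> 1 + p * W + q * W = W^-1 ->
  `|p * W ^+ 2| + `|q * W ^+ 2| < 1 ->
  exists c r : R, [/\ 0 <= c < 1, 0 < r & contracts_near (rational_map p q) W c r].
Proof.
move=> W0 eqW.
have [k kE] : exists k : R, k%:C = `|p * W ^+ 2| + `|q * W ^+ 2|.
  by exists (Normc.normc (p * W ^+ 2) + Normc.normc (q * W ^+ 2)); rewrite rmorphD.
have [M ME] : exists M : R, M%:C = `|p * W| + `|q * W|.
  by exists (Normc.normc (p * W) + Normc.normc (q * W)); rewrite rmorphD.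
have k0 : 0 <= k by rewrite -lecR kE addr_ge0.
have M0 : 0 <= M by rewrite -lecR ME addr_ge0.
rewrite -kE (_ : 1 = (1 : R)%:C) // ltcR => k1.
pose c := (1 + k) / 2; pose r := (1 - k) / (2 * (M + 1)).
have Mr : M * r <= 1 - c.
  rewrite /r mulrA ler_pdivrMr; last by lra.
  rewrite /c; nra.
exists c, r; split; first by rewrite /c; apply/andP; split; lra.
  by apply: divr_gt0; lra.
move=> d x y /andP[d0 dr] xd yd.
have sumle (a b : R[i]) (K : R) : K%:C = `|a| + `|b| ->
    `|a * (x - W) + b * (y - W)| <= (K * d)%:C.
  move=> KE; rewrite rmorphM /= KE (le_trans (ler_normD _ _)) // !normrM mulrDl.
  by rewrite lerD // ler_wpM2l.
set D := p * W * (x - W) + q * W * (y - W).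
have DM : `|D| <= (1 - c)%:C.
  apply: le_trans (sumle _ _ _ ME) _; rewrite lecR.
  by apply: le_trans Mr; rewrite ler_wpM2l.
have cD : c%:C <= `|1 + D|.
  have := lerB_dist 1 (- D); rewrite opprK normrN normr1; apply: le_trans.
  rewrite lerBrDr -lerBrDl.
  by rewrite -[1]/((1 : R)%:C) -rmorphB.
have c0 : 0 < c by rewrite /c; lra.
have D0 : 1 + D != 0 by rewrite -normr_gt0 (lt_le_trans _ cD) // ltcR.
have den : 1 + p * x + q * y = (1 + D) / W.
  have -> : (1 + D) / W = W^-1 + (p * (x - W) + q * (y - W)).
    by rewrite /D; field; exact: W0.
  by rewrite -eqW; ring.
exists (W / (1 + D)).
  rewrite /rational_map den mulf_eq0 invr_eq0 (negbTE D0) (negbTE W0) /=.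
  by rewrite div1r invf_div.
have -> : W / (1 + D) - W =
    - (p * W ^+ 2 * (x - W) + q * W ^+ 2 * (y - W)) / (1 + D).
  by rewrite /D; field; exact: D0.
rewrite normrM normrN normfV ler_pdivrMr ?normr_gt0 //.
apply: le_trans (sumle _ _ _ kE) _.
apply: (@le_trans _ _ ((c * d)%:C * c%:C)); last first.
  by apply: ler_wpM2l => //; rewrite lecR mulr_ge0 // ltW.
rewrite -rmorphM lecR mulrAC ler_wpM2r // /c; nra.
Qed.

(** The principal square root has nonnegative real part, so it is never [-1]. *)
Lemma sqrtc_add1_neq0 (R : rcfType) (z : R[i]) : 1 + sqrtc z != 0.
Proof.
case: z => a b; rewrite eq_complex negb_and /=; apply/orP; left.
by rewrite gt_eqF // ltr_wpDr ?sqrtr_ge0.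
Qed.

(* [sqrtc] is the principal square root. *)
Theorem theorem3p2 (R : realType) (p q : R[i]) :
  p + q != 0 ->
  `|4 * p / (1 + sqrtc (1 + 4 * p + 4 * q)) ^+ 2| +
    `|4 * q / (1 + sqrtc (1 + 4 * p + 4 * q)) ^+ 2| < 1 ->
  let wbar2 : R[i] := (-1 + sqrtc (1 + 4 * p + 4 * q)) / (2 * (p + q)) in
  is_equilibrium (rational_map p q) wbar2 /\
  locally_asymptotically_stable (rational_map p q) wbar2.
Proof.
move=> pq0.
have s0 := @sqrtc_add1_neq0 R (1 + 4 * p + 4 * q).
have s2 := sqr_sqrtc (1 + 4 * p + 4 * q).
move: (sqrtc _) s0 s2 => s s0 s2 hsum.
have pqs : 4 * (p + q) = (s - 1) * (s + 1).
  have -> : (s - 1) * (s + 1) = s ^+ 2 - 1 by ring.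
  by rewrite s2; ring.
have two0 : (2 : R[i]) != 0 by rewrite pnatr_eq0.
rewrite /= (_ : (-1 + s) / (2 * (p + q)) = 2 / (1 + s)); last first.
  apply/eqP; rewrite eqr_div ?mulf_neq0 //; apply/eqP.
  by rewrite mulrA -natrM pqs; ring.
set W := 2 / (1 + s).
have W0 : W != 0 by rewrite mulf_neq0 // invr_eq0.
have eqW : 1 + p * W + q * W = W^-1.
  rewrite -addrA -mulrDl.
  have -> : p + q = (s - 1) * (s + 1) / 4.
    by rewrite -pqs mulrC mulKf // pnatr_eq0.
  by rewrite /W; field; exact: s0.
split.
  by rewrite /is_equilibrium /rational_map eqW invr_eq0 (negbTE W0) div1r invrK.
have WE (a : R[i]) : a * W ^+ 2 = 4 * a / (1 + s) ^+ 2.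
  by rewrite /W; field; exact: s0.
have := @rational_map_contracts R p q W W0 eqW.
rewrite !WE => /(_ hsum)[c [r [c01 r0 hc]]].
exact: contracts_near_asymptotically_stable c01 r0 hc.
Qed.
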